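(* Let $\langle X\mid R\rangle$ be a presentation with balanced relators, with $X$ finite, and let $\varphi\colon\mathcal{O}\hookrightarrow U$ be a continuous open monomorphism of topological groups, where $\mathcal{O}$ is an open subgroup of $U$ and $\varphi(\mathcal{O})\subseteq\mathcal{O}$. Then the following hold: (1) The base group $U$, a closed subgroup of $G_\varphi$, is cocompact in $G_\varphi$ if and only if $X=\varnothing$. (2) The discrete group $G:=F(X)/\langle\langle R\rangle\rangle$, a closed subgroup of $G_\varphi$, is cocompact in $G_\varphi$ if and only if either $X=\varnothing$ and $U$ is compact, or $\varphi(\mathcal{O})=\mathcal{O}=U$ and $U$ is compact.
   Context: All topological groups are Hausdorff. A continuous open monomorphism is an injective group homomorphism that is continuous and open. For a finite set $X$, $\mathcal{H}_X(\varphi)=(U*F(X))/\langle\langle t\omega t^{-1}\varphi(\omega)^{-1}\mid t\in X,\omega\in\mathcal{O}\rangle\rangle$ (with $\mathcal{H}_\varnothing(\varphi)=U$), endowed with the unique group topology making the canonical embedding $U\hookrightarrow\mathcal{H}_X(\varphi)$ continuous and open. For a presentation $\langle X\mid R\rangle$ with $X$ finite, $G_\varphi:=\mathcal{H}_X(\varphi)/\langle\langle R\rangle\rangle$, with the quotient topology. The presentation has balanced relators if every $r\in R$ lies in the kernel of the homomorphism $F(X)\to\mathbb{Z}$ sending each $x\in X$ to $1$; in this case the canonical map $U\to G_\varphi$ is injective with open image, and $G=F(X)/\langle\langle R\rangle\rangle$ embeds via $x\mapsto x$ as a discrete (hence closed) subgroup of $G_\varphi$; both are identified with their images. A closed subgroup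 $H\le G_\varphi$ is cocompact if $G_\varphi/H$ is compact. *)

(* Defs.v *)
From HB Require Import structures.
From mathcomp Require Import all_boot all_order all_algebra.
From mathcomp Require Import all_classical topology.

Set Implicit Arguments.
Unset Strict Implicit.
Unset Printing Implicit Defensive.

Import GRing.Theory.

Local Open Scope classical_set_scope.
Local Open Scope quotient_scope.
Local Open Scope group_scope.

HB.mixin Record isTopGroup T of monoid.Group T & Topological T := {
  mulg_continuous : continuous (fun p : T * T => p.1 * p.2 : T);
  invg_continuous : continuous (fun x : T => x^-1 : T)
}.

#[short(type="topGroupType")]
HB.structure Definition TopGroup :=
  {T of isTopGroup T & monoid.Group T & Topological T}.

Record subgroup (G : groupType) := Subgroup {
  sgset :> set G;
  subgroup1 : sgset 1;
  subgroupM : forall x y, sgset x -> sgset y -> sgset (x * y);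
  subgroupV : forall x, sgset x -> sgset x^-1
}.

Definition normal_subgroup (G : groupType) (N : subgroup G) :=
  forall x y : G, sgset N x -> sgset N (y * x * y^-1).

(** The space [G / H] of left cosets [x H]. *)
Section CosetSpace.
Variables (G : groupType) (H : subgroup G).

Definition coset_eq : rel G := fun x y => `[< sgset H (x^-1 * y) >].

Lemma coset_eq_refl : reflexive coset_eq.
Proof. by move=> x; apply/asboolP; rewrite mulVg; exact: subgroup1. Qed.

Lemma coset_eq_sym : symmetric coset_eq.
Proof.
by move=> x y; apply/asboolP/asboolP => /subgroupV; rewrite invgM invgK.
Qed.

Lemma coset_eq_trans : transitive coset_eq.
Proof.
move=> y x z /asboolP xy /asboolP yz; apply/asboolP.
by have := subgroupM xy yz; rewrite mulgA mulgK.
Qed.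

Canonical coset_equiv :=
  EquivRel coset_eq coset_eq_refl coset_eq_sym coset_eq_trans.

Definition coset_space := {eq_quot coset_eq}.
HB.instance Definition _ := EqQuotient.on coset_space.
HB.instance Definition _ := Choice.on coset_space.

Definition coset_proj (x : G) : coset_space := \pi x.

Lemma coset_projP x y : reflect (sgset H (x^-1 * y)) (coset_proj x == coset_proj y).
Proof. by rewrite eqmodE; exact: asboolP. Qed.

Lemma coset_proj_eq x y : coset_proj x = coset_proj y <-> sgset H (x^-1 * y).
Proof. by split=> [/eqP /coset_projP|/coset_projP /eqP]. Qed.

Lemma coset_projK (c : coset_space) : coset_proj (repr c) = c.
Proof. exact: reprK. Qed.

End CosetSpace.

Section QuotientGroup.
Variable G : groupType.

Definition normal_closure_set (S : set G) : set G :=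
  [set x | forall N : subgroup G, normal_subgroup N -> S `<=` N -> sgset N x].

Definition normal_closure (S : set G) : subgroup G.
Proof.
exists (normal_closure_set S).
- by move=> N _ _; exact: subgroup1.
- by move=> x y Sx Sy N nN SN; apply: subgroupM; [exact: Sx|exact: Sy].
- by move=> x Sx N nN SN; apply: subgroupV; exact: Sx.
Defined.

Lemma normal_closure_normal S : normal_subgroup (normal_closure S).
Proof. by move=> x y Sx N nN SN; apply: (nN); exact: Sx. Qed.

Lemma sub_normal_closure S : S `<=` normal_closure S.
Proof. by move=> x Sx N _; exact. Qed.

(** [G / <<S>>]; for a topological group [G] it carries the quotient topology. *)
Definition quot_group (S : set G) := coset_space (normal_closure S).

Variable S : set G.
Local Notation Q := (quot_group S).
Local Notation N := (normal_closure S).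

HB.instance Definition _ := EqQuotient.on Q.
HB.instance Definition _ := Choice.on Q.

Definition quot_proj (x : G) : Q := coset_proj N x.
Definition quot_mul (a b : Q) : Q := quot_proj (repr a * repr b).
Definition quot_inv (a : Q) : Q := quot_proj (repr a)^-1.

Lemma quot_proj_eq x y : quot_proj x = quot_proj y <-> sgset N (x^-1 * y).
Proof. exact: coset_proj_eq. Qed.

Lemma quot_projK (a : Q) : quot_proj (repr a) = a.
Proof. exact: reprK. Qed.

Lemma repr_quot x : sgset N ((repr (quot_proj x))^-1 * x).
Proof. by apply/quot_proj_eq; rewrite quot_projK. Qed.

Lemma quot_mulE x y : quot_mul (quot_proj x) (quot_proj y) = quot_proj (x * y).
Proof.
rewrite /quot_mul; apply/quot_proj_eq.
set x' := repr _; set y' := repr _.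
have Nx : sgset N (x'^-1 * x) by exact: repr_quot.
have Ny : sgset N (y'^-1 * y) by exact: repr_quot.
have -> : (x' * y')^-1 * (x * y) =
    (y'^-1 * (x'^-1 * x) * y'^-1^-1) * (y'^-1 * y).
  by rewrite invgM invgK !mulgA mulgK.
by apply: subgroupM Ny; exact: normal_closure_normal.
Qed.

Lemma quot_invE x : quot_inv (quot_proj x) = quot_proj x^-1.
Proof.
rewrite /quot_inv; apply/quot_proj_eq; set x' := repr _.
have Nx : sgset N (x'^-1 * x) by exact: repr_quot.
have -> : x'^-1^-1 * x^-1 = x' * (x'^-1 * x)^-1 * x'^-1.
  by rewrite invgM invgK !mulgA mulgK.
by apply: normal_closure_normal; exact: subgroupV.
Qed.

Lemma quot_mulA : associative quot_mul.
Proof.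
move=> a b c; rewrite -(quot_projK a) -(quot_projK b) -(quot_projK c).
by rewrite !quot_mulE mulgA.
Qed.

Lemma quot_mul1 : left_id (quot_proj 1) quot_mul.
Proof. by move=> a; rewrite -(quot_projK a) quot_mulE mul1g. Qed.

Lemma quot_mulr1 : right_id (quot_proj 1) quot_mul.
Proof. by move=> a; rewrite -(quot_projK a) quot_mulE mulg1. Qed.

Lemma quot_mulV : left_inverse (quot_proj 1) quot_inv quot_mul.
Proof. by move=> a; rewrite -(quot_projK a) quot_invE quot_mulE mulVg. Qed.

Lemma quot_mulrV : right_inverse (quot_proj 1) quot_inv quot_mul.
Proof. by move=> a; rewrite -(quot_projK a) quot_invE quot_mulE mulgV. Qed.

HB.instance Definition _ := isGroup.Build Q
  quot_mulA quot_mul1 quot_mulr1 quot_mulV quot_mulrV.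

Lemma quot_projF : {morph quot_proj : x y / x / y}.
Proof. by move=> x y; rewrite -quot_mulE -quot_invE. Qed.

HB.instance Definition _ := isGroupMorphism.Build G Q quot_proj quot_projF.

End QuotientGroup.

Section CosetTopology.
Variables (G : topGroupType) (H : subgroup G).
Local Notation Q := (coset_space H).

Definition coset_open (V : set Q) := open (coset_proj H @^-1` V).

Let coset_openT : coset_open setT.
Proof. by rewrite /coset_open preimage_setT; exact: openT. Qed.

Let coset_openI (V W : set Q) : coset_open V -> coset_open W -> coset_open (V `&` W).
Proof. by move=> oV oW; exact: openI. Qed.

Let coset_open_bigU (I : Type) (f : I -> set Q) :
  (forall i, coset_open (f i)) -> coset_open (\bigcup_i f i).
Proof.
by move=> of_; rewrite /coset_open preimage_bigcup; apply: bigcup_open => i _; exact: of_.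
Qed.

HB.instance Definition _ :=
  isOpenTopological.Build Q coset_openT coset_openI coset_open_bigU.

Lemma coset_proj_continuous : continuous (coset_proj H).
Proof. by apply/continuousP => V. Qed.

Lemma mulg_open (x : G) (W : set G) : open W -> open [set y | W (y * x)].
Proof.
move=> oW; have /continuousP : continuous (fun y : G => y * x).
  move=> y.
  apply: (@continuous_comp _ _ _ (fun y : G => (y, x)) (fun p : G * G => p.1 * p.2)).
    by apply: cvg_pair => //; exact: cvg_cst.
  exact: mulg_continuous.
exact.
Qed.

Lemma lmulg_open (x : G) (W : set G) : open W -> open [set y | W (x * y)].
Proof.
move=> oW; have /continuousP : continuous (fun y : G => x * y).
  move=> y.
  apply: (@continuous_comp _ _ _ (fun y : G => (x, y)) (fun p : G * G => p.1 * p.2)).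
    by apply: cvg_pair => //; exact: cvg_cst.
  exact: mulg_continuous.
exact.
Qed.

Lemma invg_open (W : set G) : open W -> open [set y : G | W y^-1].
Proof. by have /continuousP := @invg_continuous G; exact. Qed.

Lemma coset_proj_open (W : set G) : open W -> open (coset_proj H @` W).
Proof.
move=> oW; rewrite /open /= /coset_open.
have -> : coset_proj H @^-1` (coset_proj H @` W) =
    \bigcup_(h in sgset H) [set x | W (x * h)].
  apply/seteqP; split=> x /=.
    move=> [y Wy /coset_proj_eq Hyx]; exists (y^-1 * x)^-1; first exact: subgroupV.
    by rewrite /= invgM invgK mulVKg.
  move=> [h Hh Wxh]; exists (x * h) => //; apply/coset_proj_eq.
  by rewrite invgM mulgVK; exact: subgroupV.
by apply: bigcup_open => h _; exact: mulg_open.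
Qed.

End CosetTopology.

Section QuotientTopGroup.
Variables (G : topGroupType) (S : set G).
Local Notation Q := (quot_group S).

HB.instance Definition _ := Topological.copy Q (coset_space (normal_closure S)).

Let quot_mul_continuous : continuous (fun p : Q * Q => p.1 * p.2 : Q).
Proof.
move=> [a b] V /=; rewrite -(quot_projK a) -(quot_projK b) -gmulfM.
rewrite nbhsE => -[V' [oV' V'ab] V'V].
have : nbhs (repr a, repr b)
    ((fun p : G * G => p.1 * p.2) @^-1` (@quot_proj G S @^-1` V')).
  by apply: mulg_continuous; apply: open_nbhs_nbhs; split.
move=> [[A B] /= [nA nB] AB].
move: nA nB; rewrite (nbhsE (repr a)) (nbhsE (repr b)).
move=> [A' [oA' A'a] A'A] [B' [oB' B'b] B'B].
exists (@quot_proj G S @` A', @quot_proj G S @` B') => /=.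
  split; apply: open_nbhs_nbhs; split.
  - exact: coset_proj_open.
  - by exists (repr a).
  - exact: coset_proj_open.
  - by exists (repr b).
move=> [_ _] /= [[x A'x <-] [y B'y <-]]; apply: V'V; rewrite -gmulfM.
by apply: (AB (x, y)); split; [exact: A'A|exact: B'B].
Qed.

Let quot_inv_continuous : continuous (fun a : Q => a^-1 : Q).
Proof.
apply/continuousP => V oV.
rewrite /open /= /coset_open.
have -> : coset_proj (normal_closure S) @^-1` ((fun a : Q => a^-1) @^-1` V) =
    [set x | (@quot_proj G S @^-1` V) x^-1].
  by apply/seteqP; split=> x /=; rewrite gmulfV.
exact: invg_open.
Qed.

HB.instance Definition _ :=
  isTopGroup.Build Q quot_mul_continuous quot_inv_continuous.

End QuotientTopGroup.

(** Monoid presentations in which every letter has a letter as two-sided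
    inverse; the monoid they present is a group. *)
Inductive wcongr (A : Type) (rel : seq A -> seq A -> Prop) :
    seq A -> seq A -> Prop :=
| wcongr_rel u v : rel u v -> wcongr rel u v
| wcongr_refl u : wcongr rel u u
| wcongr_sym u v : wcongr rel u v -> wcongr rel v u
| wcongr_trans u v w : wcongr rel u v -> wcongr rel v w -> wcongr rel u w
| wcongr_cat u u' v v' :
    wcongr rel u u' -> wcongr rel v v' -> wcongr rel (u ++ v) (u' ++ v').

Record wpres := WPres {
  letter : choiceType;
  wrel : seq letter -> seq letter -> Prop;
  linv : letter -> letter;
  wrelV : forall a, wcongr wrel [:: a; linv a] [::];
  wrelVl : forall a, wcongr wrel [:: linv a; a] [::]
}.

Section WordGroup.
Variable P : wpres.
Local Notation "u ~ v" := (wcongr (@wrel P) u v) (at level 70).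

Definition wequiv : rel (seq (letter P)) := fun u v => `[< u ~ v >].

Lemma wequiv_refl : reflexive wequiv.
Proof. by move=> u; apply/asboolP; exact: wcongr_refl. Qed.

Lemma wequiv_sym : symmetric wequiv.
Proof. by move=> u v; apply/asboolP/asboolP; exact: wcongr_sym. Qed.

Lemma wequiv_trans : transitive wequiv.
Proof.
by move=> v u w /asboolP uv /asboolP vw; apply/asboolP; exact: wcongr_trans vw.
Qed.

Canonical wequiv_equiv := EquivRel wequiv wequiv_refl wequiv_sym wequiv_trans.

Definition wgroup := {eq_quot wequiv}.
HB.instance Definition _ := EqQuotient.on wgroup.
HB.instance Definition _ := Choice.on wgroup.

Definition wclass (u : seq (letter P)) : wgroup := \pi u.

Lemma wclass_eq u v : wclass u = wclass v <-> u ~ v.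
Proof.
by split=> [/eqP|?]; [|apply/eqP]; rewrite eqmodE; [move/asboolP|exact/asboolP].
Qed.

Lemma wclassK (g : wgroup) : wclass (repr g) = g.
Proof. exact: reprK. Qed.

Lemma repr_wclass u : repr (wclass u) ~ u.
Proof. by apply/wclass_eq; rewrite wclassK. Qed.

Definition winv (u : seq (letter P)) := rev (map (@linv P) u).

Lemma wcongrV u : u ++ winv u ~ [::].
Proof.
elim: u => [|a u IH]; first exact: wcongr_refl.
have -> : (a :: u) ++ winv (a :: u) = [:: a] ++ ((u ++ winv u) ++ [:: linv a]).
  by rewrite /winv /= rev_cons -cats1 -!catA.
apply: (wcongr_trans _ (wrelV a)).
rewrite -[[:: a; _]]/([:: a] ++ ([::] ++ [:: linv a])).
by do 2?[apply: wcongr_cat]; [exact: wcongr_refl|exact: IH|exact: wcongr_refl].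
Qed.

Lemma wcongrVl u : winv u ++ u ~ [::].
Proof.
elim: u => [|a u IH]; first exact: wcongr_refl.
have -> : winv (a :: u) ++ a :: u = winv u ++ ([:: linv a; a] ++ u).
  by rewrite /winv /= rev_cons -cats1 -!catA.
apply: (wcongr_trans _ IH); rewrite -[X in _ ~ _ ++ X]cat0s.
by do 2?[apply: wcongr_cat]; [exact: wcongr_refl|exact: wrelVl|exact: wcongr_refl].
Qed.

Lemma wcongr_winv u v : u ~ v -> winv u ~ winv v.
Proof.
move=> uv; apply: (@wcongr_trans _ _ _ (winv u ++ (v ++ winv v))).
  rewrite -[X in X ~ _]cats0; apply: wcongr_cat; first exact: wcongr_refl.
  exact/wcongr_sym/wcongrV.
rewrite catA -[X in _ ~ X]cat0s; apply: wcongr_cat; last exact: wcongr_refl.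
apply: wcongr_trans (wcongrVl u); apply: wcongr_cat; first exact: wcongr_refl.
exact: wcongr_sym.
Qed.

Definition wgroup_mul (g h : wgroup) := wclass (repr g ++ repr h).
Definition wgroup_inv (g : wgroup) := wclass (winv (repr g)).

Lemma wgroup_mulE u v : wgroup_mul (wclass u) (wclass v) = wclass (u ++ v).
Proof. by apply/wclass_eq; apply: wcongr_cat; exact: repr_wclass. Qed.

Lemma wgroup_invE u : wgroup_inv (wclass u) = wclass (winv u).
Proof. by apply/wclass_eq/wcongr_winv; exact: repr_wclass. Qed.

Let mulA : associative wgroup_mul.
Proof.
move=> f g h; rewrite -(wclassK f) -(wclassK g) -(wclassK h).
by rewrite !wgroup_mulE catA.
Qed.

Let mul1 : left_id (wclass [::]) wgroup_mul.
Proof. by move=> g; rewrite -(wclassK g) wgroup_mulE. Qed.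

Let mulr1 : right_id (wclass [::]) wgroup_mul.
Proof. by move=> g; rewrite -(wclassK g) wgroup_mulE cats0. Qed.

Let mulV : left_inverse (wclass [::]) wgroup_inv wgroup_mul.
Proof.
move=> g; rewrite -(wclassK g) wgroup_invE wgroup_mulE.
by apply/wclass_eq; exact: wcongrVl.
Qed.

Let mulrV : right_inverse (wclass [::]) wgroup_inv wgroup_mul.
Proof.
move=> g; rewrite -(wclassK g) wgroup_invE wgroup_mulE.
by apply/wclass_eq; exact: wcongrV.
Qed.

HB.instance Definition _ := isGroup.Build wgroup mulA mul1 mulr1 mulV mulrV.

Lemma wclass_cat u v : wclass (u ++ v) = wclass u * wclass v.
Proof. by rewrite -wgroup_mulE. Qed.

Lemma wgroup_ind (Q : wgroup -> Prop) : Q 1 ->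
  (forall a g, Q g -> Q (wclass [:: a] * g)) -> forall g, Q g.
Proof.
move=> Q1 QM g; rewrite -(wclassK g).
elim: (repr g) => [//|a u IH]; rewrite -cat1s wclass_cat; exact: QM.
Qed.

End WordGroup.

Section FreeGroup.
Variable X : choiceType.

(** The letter [(x, true)] stands for [x] and [(x, false)] for [x^-1]. *)
Inductive fg_rel : seq (X * bool) -> seq (X * bool) -> Prop :=
| fg_cancel x b : fg_rel [:: (x, b); (x, ~~ b)] [::].

Let fg_linv (a : X * bool) := (a.1, ~~ a.2).

Let fg_relV a : wcongr fg_rel [:: a; fg_linv a] [::].
Proof. by case: a => x b; apply: wcongr_rel; exact: fg_cancel. Qed.

Let fg_relVl a : wcongr fg_rel [:: fg_linv a; a] [::].
Proof.
case: a => x b; apply: wcongr_rel.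
by have := fg_cancel x (~~ b); rewrite negbK.
Qed.

Definition free_group_pres := @WPres _ fg_rel fg_linv fg_relV fg_relVl.
Definition free_group := wgroup free_group_pres.
HB.instance Definition _ := EqQuotient.on free_group.
HB.instance Definition _ := monoid.Group.on free_group.

Definition fg_gen (x : X) : free_group := @wclass free_group_pres [:: (x, true)].

Lemma fg_genV x : @wclass free_group_pres [:: (x, false)] = (fg_gen x)^-1.
Proof.
by apply/esym/mulg1_eq; rewrite -wclass_cat; apply/wclass_eq; exact: fg_relV.
Qed.

Definition word_exponent_sum (u : seq (X * bool)) : int :=
  (\sum_(a <- u) (if a.2 then 1 else -1))%R.

(** The homomorphism to [int] sending every generator to [1]. *)
Definition exponent_sum (g : free_group) : int :=
  word_exponent_sum (repr (g : wgroup free_group_pres)).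

Lemma exponent_sumE u : exponent_sum (@wclass free_group_pres u) = word_exponent_sum u.
Proof.
have : wcongr fg_rel (repr (@wclass free_group_pres u)) u.
  exact: (@repr_wclass free_group_pres u).
rewrite /exponent_sum; move: (repr _) => v.
elim=> [_ _ [x b]|//|//|_ _ _ _ -> _ ->//|u1 u2 v1 v2 _ IHu _ IHv].
  by rewrite /word_exponent_sum !big_cons big_nil; case: b.
by move: IHu IHv; rewrite /word_exponent_sum !big_cat /= => -> ->.
Qed.

Lemma exponent_sum_gen x : exponent_sum (fg_gen x) = 1%R.
Proof. by rewrite exponent_sumE /word_exponent_sum big_seq1. Qed.

Lemma exponent_sumM g h : exponent_sum (g * h) = (exponent_sum g + exponent_sum h)%R.
Proof.
rewrite -(wclassK g) -(wclassK h) -wclass_cat !exponent_sumE.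
by rewrite /word_exponent_sum big_cat.
Qed.

End FreeGroup.

Section FreeProduct.
Variables G H : groupType.

Inductive fp_rel : seq (G + H) -> seq (G + H) -> Prop :=
| fp_mull x y : fp_rel [:: inl x; inl y] [:: inl (x * y)]
| fp_mulr x y : fp_rel [:: inr x; inr y] [:: inr (x * y)]
| fp_onel : fp_rel [:: inl 1] [::]
| fp_oner : fp_rel [:: inr 1] [::].

Let fp_linv (a : G + H) : G + H :=
  match a with inl x => inl x^-1 | inr y => inr y^-1 end.

Let fp_relV a : wcongr fp_rel [:: a; fp_linv a] [::].
Proof.
case: a => x /=.
  apply: wcongr_trans (wcongr_rel fp_onel); rewrite -(mulgV x).
  exact/wcongr_rel/fp_mull.
apply: wcongr_trans (wcongr_rel fp_oner); rewrite -(mulgV x).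
exact/wcongr_rel/fp_mulr.
Qed.

Let fp_relVl a : wcongr fp_rel [:: fp_linv a; a] [::].
Proof.
case: a => x /=.
  apply: wcongr_trans (wcongr_rel fp_onel); rewrite -(mulVg x).
  exact/wcongr_rel/fp_mull.
apply: wcongr_trans (wcongr_rel fp_oner); rewrite -(mulVg x).
exact/wcongr_rel/fp_mulr.
Qed.

Definition free_product_pres := @WPres _ fp_rel fp_linv fp_relV fp_relVl.
Definition free_product := wgroup free_product_pres.
HB.instance Definition _ := EqQuotient.on free_product.
HB.instance Definition _ := monoid.Group.on free_product.

Definition fp_inl (x : G) : free_product := @wclass free_product_pres [:: inl x].
Definition fp_inr (y : H) : free_product := @wclass free_product_pres [:: inr y].

Let fp_inlM x y : fp_inl (x * y) = fp_inl x * fp_inl y.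
Proof. by rewrite -wclass_cat; apply/esym/wclass_eq/wcongr_rel; exact: fp_mull. Qed.

Let fp_inrM x y : fp_inr (x * y) = fp_inr x * fp_inr y.
Proof. by rewrite -wclass_cat; apply/esym/wclass_eq/wcongr_rel; exact: fp_mulr. Qed.

Let fp_inlF : {morph fp_inl : x y / x / y}.
Proof.
move=> x y; apply: (mulIg (fp_inl y)).
by rewrite -fp_inlM !mulgVK.
Qed.

Let fp_inrF : {morph fp_inr : x y / x / y}.
Proof.
move=> x y; apply: (mulIg (fp_inr y)).
by rewrite -fp_inrM !mulgVK.
Qed.

HB.instance Definition _ := isGroupMorphism.Build G free_product fp_inl fp_inlF.
HB.instance Definition _ := isGroupMorphism.Build H free_product fp_inr fp_inrF.

End FreeProduct.

Section RangeSubgroup.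
Variables (G H : groupType) (f : UMagmaMorphism.type G H).

Let range1 : range f 1.
Proof. by exists 1; rewrite ?gmulf1. Qed.

Let rangeM x y : range f x -> range f y -> range f (x * y).
Proof. by move=> [a _ <-] [b _ <-]; exists (a * b); rewrite ?gmulfM. Qed.

Let rangeV x : range f x -> range f x^-1.
Proof. by move=> [a _ <-]; exists a^-1; rewrite ?gmulfV. Qed.

Definition range_subgroup : subgroup H := Subgroup range1 rangeM rangeV.

Definition kernel_subgroup : subgroup G.
Proof.
exists [set x | f x = 1] => /=; first exact: gmulf1.
- by move=> x y; rewrite gmulfM => -> ->; rewrite mulg1.
- by move=> x; rewrite gmulfV => ->; rewrite invg1.
Defined.

Lemma kernel_normal : normal_subgroup kernel_subgroup.
Proof. by move=> x y /= fx; rewrite !gmulfM gmulfV fx mulg1 mulgV. Qed.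

End RangeSubgroup.

(** A continuous open monomorphism [phi] from an open subgroup [om_dom] of [U]
    to [U]; the values of the underlying total function outside [om_dom]
    are junk. *)
Record open_mono (U : topGroupType) := OpenMono {
  om_dom : subgroup U;
  om_fun :> U -> U;
  om_dom_open : open om_dom;
  om_morph : forall x y, sgset om_dom x -> sgset om_dom y ->
    om_fun (x * y) = om_fun x * om_fun y;
  om_inj : set_inj om_dom om_fun;
  om_continuous : {within om_dom, continuous om_fun};
  om_open : forall W, open W -> W `<=` om_dom -> open (om_fun @` W)
}.

Section HNN.
Variables (U : topGroupType) (phi : open_mono U) (X : finType).
Local Notation O := (sgset (om_dom phi)).
Local Notation P := (free_product U (free_group X)).

Definition hnn_relators : set P :=
  [set g | exists t w, O w /\
    g = fp_inr U (fg_gen t) * fp_inl _ w * (fp_inr U (fg_gen t))^-1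
        * (fp_inl _ (phi w))^-1].

Definition hnn := quot_group hnn_relators.
HB.instance Definition _ := monoid.Group.on hnn.

Definition hnn_base (u : U) : hnn := quot_proj hnn_relators (fp_inl _ u).
Definition hnn_free (f : free_group X) : hnn := quot_proj hnn_relators (fp_inr _ f).

HB.instance Definition _ := UMagmaMorphism.copy hnn_base
  (@quot_proj _ hnn_relators \o @fp_inl U (free_group X)).
HB.instance Definition _ := UMagmaMorphism.copy hnn_free
  (@quot_proj _ hnn_relators \o @fp_inr U (free_group X)).

Lemma hnn_rel t w : O w ->
  hnn_free (fg_gen t) * hnn_base w = hnn_base (phi w) * hnn_free (fg_gen t).
Proof.
move=> Ow; apply: (mulIg (hnn_free (fg_gen t))^-1); rewrite mulgK.
apply: (mulIg (hnn_base (phi w))^-1); rewrite mulgV.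
have e1 : quot_proj hnn_relators 1 = 1 by exact: gmulf1.
pose r := fp_inr U (fg_gen t) * fp_inl (free_group X) w
  * (fp_inr U (fg_gen t))^-1 * (fp_inl (free_group X) (phi w))^-1.
have : quot_proj hnn_relators r = 1.
  rewrite -e1; apply/esym/quot_proj_eq; rewrite invg1 mul1g.
  by apply: sub_normal_closure; exists t, w.
by rewrite /r !gmulfM !gmulfV.
Qed.

(** The topology on [hnn] in which [V] is open when every left translate of
    [V] has open preimage in [U]. It is a group topology (the [isTopGroup]
    instance below), and by [hnn_base_continuous], [hnn_base_open] and
    [hnn_topology_unique] it is the unique one for which [hnn_base] is
    continuous and open. *)
Definition hnn_open (V : set hnn) := forall g, open [set u | V (g * hnn_base u)].

Let hnn_openT : hnn_open setT.
Proof. by move=> g; exact: openT. Qed.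

Let hnn_openI (V W : set hnn) : hnn_open V -> hnn_open W -> hnn_open (V `&` W).
Proof. by move=> oV oW g; exact: openI (oV g) (oW g). Qed.

Let hnn_open_bigU (I : Type) (f : I -> set hnn) :
  (forall i, hnn_open (f i)) -> hnn_open (\bigcup_i f i).
Proof.
move=> of_ g.
have -> : [set u | (\bigcup_i f i) (g * hnn_base u)] =
  \bigcup_i [set u | f i (g * hnn_base u)] by [].
by apply: bigcup_open => i _; exact: of_.
Qed.

HB.instance Definition _ :=
  isOpenTopological.Build hnn hnn_openT hnn_openI hnn_open_bigU.

Lemma hnn_ind (Q : hnn -> Prop) :
  Q 1 -> (forall g h, Q g -> Q h -> Q (g * h)) ->
  (forall u, Q (hnn_base u)) -> (forall t, Q (hnn_free (fg_gen t))) ->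
  (forall t, Q (hnn_free (fg_gen t))^-1) -> forall g, Q g.
Proof.
move=> Q1 QM Qb Qt QtV g; rewrite -(quot_projK g).
have Qf f : Q (hnn_free f).
  elim/wgroup_ind: f => [|[t b] f IHf].
    by have <- : 1 = hnn_free 1 by rewrite gmulf1.
  have -> : hnn_free (@wclass (free_group_pres X) [:: (t, b)] * f) =
      hnn_free (@wclass (free_group_pres X) [:: (t, b)]) * hnn_free f by rewrite -gmulfM.
  apply: QM => //; case: b; first exact: Qt.
  by rewrite fg_genV gmulfV; exact: QtV.
have {Qf}Qa (a : U + free_group X) :
    Q (quot_proj hnn_relators (@wclass (free_product_pres U (free_group X)) [:: a])).
  by case: a.
elim/wgroup_ind: (repr g) => [|a x IH].
  by have <- : 1 = quot_proj hnn_relators 1 by rewrite gmulf1.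
have -> : quot_proj hnn_relators (wclass [:: a] * x) =
    quot_proj hnn_relators (wclass [:: a]) * quot_proj hnn_relators x.
  by rewrite -gmulfM.
exact: QM.
Qed.

Lemma om1 : phi 1 = 1.
Proof.
apply: (mulIg (phi 1)); rewrite mul1g -om_morph ?mulg1 //; exact: subgroup1.
Qed.

Lemma hnn_commute (g : hnn) (W : set U) : open W -> W 1 ->
  exists W' : set U, [/\ open W', W' 1 & forall w', W' w' ->
    exists2 w, W w & hnn_base w' * g = g * hnn_base w].
Proof.
elim/hnn_ind: g W => [W oW W1|g h IHg IHh W oW W1|u W oW W1|t W oW W1|t W oW W1].
- by exists W; split=> // w Ww; exists w; rewrite // mulg1 mul1g.
- have [W2 [oW2 W21 W2P]] := IHh W oW W1.
  have [W3 [oW3 W31 W3P]] := IHg W2 oW2 W21.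
  exists W3; split=> // w3 /W3P[w2 /W2P[w Ww e2] e3].
  by exists w => //; rewrite mulgA e3 -!mulgA e2.
- exists [set x | W (u^-1 * (x * u))]; split.
  + exact: (@mulg_open _ u [set y | W (u^-1 * y)]) (lmulg_open _ oW).
  + by rewrite /= mul1g mulVg.
  + move=> x Wx; exists (u^-1 * (x * u)) => //.
    by rewrite -!gmulfM mulVKg.
- exists (phi @` (W `&` O)); split.
  + by apply: om_open => //; apply: openI => //; exact: om_dom_open.
  + by exists 1; [split=> //; exact: subgroup1|exact: om1].
  + by move=> _ [w [Ww Ow] <-]; exists w => //; rewrite hnn_rel.
- exists (O `&` phi @^-1` W); split.
  + rewrite openE => x [Ox Wx].
    have := @om_continuous _ phi.
    rewrite continuous_open_subspace; last exact: om_dom_open.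
    move=> /(_ x); rewrite inE => /(_ Ox) cx; apply: filterI.
      by apply: open_nbhs_nbhs; split=> //; exact: om_dom_open.
    by apply: cx; apply: open_nbhs_nbhs.
  + by split; [exact: subgroup1|rewrite /= om1].
  + move=> w [Ow Ww]; exists (phi w) => //.
    apply: (mulgI (hnn_free (fg_gen t))); rewrite mulVKg mulgA hnn_rel //.
    by rewrite mulgK.
Qed.

Lemma hnn_base_continuous : continuous hnn_base.
Proof.
apply/continuousP => V /(_ 1); congr (open _).
by apply/seteqP; split=> u /=; rewrite mul1g.
Qed.

Lemma hnn_lbase_open g (W : set U) : open W -> open [set g * hnn_base w | w in W].
Proof.
move=> oW; rewrite /open /= => h; rewrite openE => u0 [w0 Ww0 e0].
have e u : h * hnn_base u = g * hnn_base (w0 * (u0^-1 * u)).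
  by rewrite gmulfM mulgA e0 -mulgA -gmulfM mulVKg.
rewrite /interior nbhsE; exists [set u | W (w0 * (u0^-1 * u))]; first split.
- exact: (@lmulg_open _ u0^-1 [set y | W (w0 * y)]) (lmulg_open _ oW).
- by rewrite /= mulVg mulg1.
- by move=> u Wu /=; rewrite e; exists (w0 * (u0^-1 * u)).
Qed.

Lemma hnn_base_open (W : set U) : open W -> open (hnn_base @` W).
Proof.
move=> /(hnn_lbase_open 1); congr (open _).
by apply/seteqP; split=> _ [u Wu <-]; exists u; rewrite ?mul1g.
Qed.

Let hnn_mul_continuous : continuous (fun p : hnn * hnn => p.1 * p.2 : hnn).
Proof.
move=> [g h] V; rewrite /= (nbhsE (g * h)) => -[V' [oV' V'gh] V'V].
have := oV' (g * h); set W := [set u | _] => oW.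
have W1 : W 1 by rewrite /W /= gmulf1 mulg1.
have : nbhs (1 : U, 1 : U) ((fun p : U * U => p.1 * p.2) @^-1` W).
  by apply: mulg_continuous; apply: open_nbhs_nbhs; split; rewrite //= mulg1.
move=> [[A B] /= [nA nB] AB]; move: nA nB; rewrite !(nbhsE 1).
move=> [A' [oA' A'1] A'A] [B' [oB' B'1] B'B].
have [C [oC C1 CP]] := hnn_commute h oA' A'1.
exists ([set g * hnn_base u | u in C], [set h * hnn_base u | u in B']) => /=.
  split; apply: open_nbhs_nbhs; split.
  - exact: hnn_lbase_open.
  - by exists 1; rewrite // gmulf1 mulg1.
  - exact: hnn_lbase_open.
  - by exists 1; rewrite // gmulf1 mulg1.
move=> [_ _] /= [[c /CP[a A'a eca] <-] [b B'b <-]]; apply: V'V.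
have -> : g * hnn_base c * (h * hnn_base b) = g * h * hnn_base (a * b).
  by rewrite gmulfM !mulgA -(mulgA g) eca !mulgA.
by apply: (AB (a, b)); split; [exact: A'A|exact: B'B].
Qed.

Let hnn_inv_continuous : continuous (fun g : hnn => g^-1 : hnn).
Proof.
move=> g V; rewrite (nbhsE g^-1) => -[V' [oV' V'g] V'V].
have := oV' g^-1; set W := [set u | _] => oW.
have W1 : W 1 by rewrite /W /= gmulf1 mulg1.
have [C [oC C1 CP]] := hnn_commute g^-1 oW W1.
rewrite /= nbhsE.
exists [set g * hnn_base u | u in [set u | C u^-1]]; first split.
- by apply: hnn_lbase_open; exact: invg_open.
- by exists 1; rewrite /= ?invg1 // gmulf1 mulg1.
- move=> _ [u /CP[w Ww e] <-]; apply: V'V.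
  by rewrite invgM -gmulfV e.
Qed.

HB.instance Definition _ :=
  isTopGroup.Build hnn hnn_mul_continuous hnn_inv_continuous.

Lemma hnn_topology_unique (K : topGroupType) (f : UMagmaMorphism.type hnn K) :
  bijective f -> continuous (f \o hnn_base) ->
  (forall W : set U, open W -> open ((f \o hnn_base) @` W)) ->
  forall V : set hnn, open V <-> open (f @` V).
Proof.
move=> [f' fK f'K] /continuousP cf of_ V; split=> oV.
  rewrite openE => _ [g Vg <-]; have oW := oV g.
  rewrite /interior nbhsE.
  exists [set y | ((f \o hnn_base) @` [set u | V (g * hnn_base u)]) ((f g)^-1 * y)].
    split; first by apply: lmulg_open; exact: of_.
    by exists 1; rewrite /= ?gmulf1 ?mulg1 ?mulVg.
  move=> y [u Vu /= e]; exists (g * hnn_base u) => //.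
  by rewrite gmulfM e mulVKg.
move=> g; have := cf _ (@lmulg_open _ (f g) _ oV); congr (open _).
apply/seteqP; split=> u /=.
  by move=> [h Vh]; rewrite -gmulfM => /(can_inj fK) <-.
by move=> Vu; exists (g * hnn_base u); rewrite // gmulfM.
Qed.

End HNN.

Section Gphi.
Variables (U : topGroupType) (phi : open_mono U) (X : finType).
Variable R : set (free_group X).

Definition balanced := forall r, R r -> exponent_sum r = 0%R.

Definition pres_group := quot_group R.
HB.instance Definition _ := monoid.Group.on pres_group.

Definition Gphi := quot_group (hnn_free phi (X := X) @` R).
HB.instance Definition _ := TopGroup.on Gphi.

Definition Gphi_base (u : U) : Gphi := quot_proj _ (hnn_base phi X u).
HB.instance Definition _ := UMagmaMorphism.copy Gphi_base
  (@quot_proj _ (hnn_free phi (X := X) @` R) \o @hnn_base U phi X).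

Let q := @quot_proj _ (hnn_free phi (X := X) @` R) \o @hnn_free U phi X.

(** The homomorphism induced by [x |-> x]. *)
Definition Gphi_pres (g : pres_group) : Gphi := q (repr g).

Lemma Gphi_presE f : Gphi_pres (quot_proj R f) = quot_proj _ (hnn_free phi f).
Proof.
have e1 : quot_proj (hnn_free phi (X := X) @` R) 1 = 1 by exact: gmulf1.
have kerR : R `<=` kernel_subgroup q.
  move=> r Rr; rewrite /= -e1; apply/esym/quot_proj_eq; rewrite invg1 mul1g.
  by apply: sub_normal_closure; exists r.
have := @repr_quot _ R f => /(_ (kernel_subgroup q) (@kernel_normal _ _ q) kerR).
rewrite /= gmulfM gmulfV -e1 => /esym/quot_proj_eq; rewrite invg1 mul1g => e.
exact/quot_proj_eq.
Qed.

Let Gphi_presF : {morph Gphi_pres : g h / g / h}.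
Proof.
move=> g h; rewrite -(quot_projK g) -(quot_projK h) -gmulfF !Gphi_presE.
by rewrite !gmulfF.
Qed.

HB.instance Definition _ := isGroupMorphism.Build pres_group Gphi Gphi_pres Gphi_presF.

End Gphi.

Arguments Gphi_base {U} phi {X} R u.
Arguments Gphi_pres {U} phi {X} R g.

Definition cocompact (G : topGroupType) (H : subgroup G) :=
  compact [set: coset_space H].

(* Main.v *)
Require Import Defs.
From mathcomp Require Import all_boot all_order all_algebra.
From mathcomp Require Import all_classical topology.

(** Let [t] be a permutation of a set on which [U] acts, satisfying
    [t (w s) = phi(w) (t s)] for [w] in [O].  Since the relators are balanced,
    [G_phi] acts on this set with every generator of [X] acting as [t].  All
    lower bounds come from such actions.

    On [int], with [U] acting trivially and [t] the successor, the powers of a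
    generator [x] move [0] to distinct points, so [G_phi / U] is infinite.  On a
    free [U]-set, a Cantor-Bernstein argument yields a [t] with prescribed values
    on a few orbits.  If [t] fixes a point [s0], then so does [G], hence [G] meets
    [U] trivially, which makes [G] closed and embeds [U] as a clopen subset of
    [G_phi / G].  If moreover [u] is not in [phi(O)], then [t] can be chosen so
    that the points [x^-n u s0] lie in distinct [U]-orbits, and [U \ G_phi / G]
    is infinite; but it is finite when [G] is cocompact, because [U] is open.

    Conversely [G_phi = U G] when [X] is empty or [phi(O) = O = U]. *)

Set Implicit Arguments.
Unset Strict Implicit.
Unset Printing Implicit Defensive.

Import GRing.Theory.

Local Open Scope classical_set_scope.
Local Open Scope group_scope.

(** * Equivariant bijections and coset representatives *)

(** [C] collects the points whose backward chain stops in [S] outside the range of [g]; [h] is [f]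
    on [C] and inverts [g] off [C]. Inverses in [D] make [C] invariant in both directions, whence
    equivariance. *)
Lemma equivariant_Cantor_Bernstein (I S S' : Type) (D : set I)
    (p : I -> S -> S) (q : I -> S' -> S') (f : S -> S') (g : S' -> S) :
  (forall w, D w -> exists2 w', D w' & cancel (p w) (p w') /\ cancel (q w) (q w')) ->
  (forall w s, D w -> f (p w s) = q w (f s)) ->
  (forall w s, D w -> g (q w s) = p w (g s)) ->
  injective f -> injective g ->
  exists h : S -> S', exists h' : S' -> S,
    [/\ cancel h h', cancel h' h, forall w s, D w -> h (p w s) = q w (h s)
      & forall s, ~ range g s -> h s = f s].
Proof.
move=> pqV fE gE fI gI.
pose C := [set s | exists n s0, ~ range g s0 /\ s = iter n (g \o f) s0].
have CgV s : ~ C s -> exists y, g y = s.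
  move=> nC; apply: contrapT => ng; apply: nC; exists 0, s.
  by split=> // -[y _ gy]; apply: ng; exists y.
have Cg y : C (g y) -> exists2 s, C s & f s = y.
  move=> [[|n] [s0 [ng e]]]; first by case: ng; exists y.
  by exists (iter n (g \o f) s0); [exists n, s0|exact/gI].
have Cgf s : C s -> C (g (f s)).
  by move=> [n [s0 [ng ->]]]; exists n.+1, s0.
have Cp w s : D w -> C s -> C (p w s).
  move=> Dw [n [s0 [ng ->]]]; exists n, (p w s0); split.
    move=> [y _ gy]; have [w' Dw' [pK _]] := pqV _ Dw.
    by apply: ng; exists (q w' y); rewrite // gE // gy pK.
  by elim: n => //= n <-; rewrite fE // gE.
have CpV w s : D w -> C (p w s) -> C s.
  by move=> Dw; have [w' Dw' [pK _]] := pqV _ Dw; move/(Cp w' _ Dw'); rewrite pK.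
have /choice[h hP] (s : S) : exists y, (C s /\ y = f s) \/ (~ C s /\ g y = s).
  have [Cs|nCs] := pselect (C s); first by exists (f s); left.
  by have [y gy] := CgV s nCs; exists y; right.
have hI : injective h.
  move=> s1 s2; case: (hP s1) (hP s2) => [[C1 h1]|[C1 g1]] [[C2 h2]|[C2 g2]].
  - by rewrite h1 h2 => /fI.
  - by move=> e; case: C2; rewrite -g2 -e h1; exact: Cgf.
  - by move=> e; case: C1; rewrite -g1 e h2; exact: Cgf.
  - by move=> e; rewrite -g1 -g2 e.
have /choice[h' h'P] (y : S') : exists s, h s = y.
  have [/Cg[s Cs fs]|nC] := pselect (C (g y)).
    by exists s; case: (hP s) => -[] // _ ->.
  by exists (g y); case: (hP (g y)) => -[] // _ /gI.
exists h, h'; split=> //.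
- by move=> s; apply: hI; rewrite h'P.
- move=> w s Dw; case: (hP s) (hP (p w s)) => [[C1 h1]|[C1 g1]] [[C2 h2]|[C2 g2]].
  + by rewrite h2 h1 fE.
  + by case: C2; exact: Cp.
  + by case: C1; exact: CpV C2.
  + by apply: gI; rewrite g2 gE // g1.
- move=> s ng; case: (hP s) => -[] // nC _.
  by case: ng; have [y gy] := CgV s nC; exists y.
Qed.

(** Inversion exchanges left and right cosets, so representatives from [coset_space] serve here
    too. *)
Lemma right_coset_transversal (G : groupType) (H : subgroup G) :
  exists r : G -> G, (forall x, sgset H (x * (r x)^-1)) /\
    (forall h x, sgset H h -> r (h * x) = r x).
Proof.
exists (fun x => (repr (coset_proj H x^-1))^-1); split=> [x|h x Hh].
  rewrite invgK -[x in x * _]invgK; apply/coset_proj_eq.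
  by rewrite coset_projK.
congr (repr _)^-1; apply/coset_proj_eq.
by rewrite invgK mulgK.
Qed.

(** * Actions of quotients, free products and [Gphi] *)

Definition is_action (G : groupType) (S : Type) (a : G -> S -> S) :=
  (forall s, a 1 s = s) /\ (forall g h s, a (g * h) s = a g (a h s)).

Lemma is_actionV (G : groupType) (S : Type) (a : G -> S -> S) g s s' :
  is_action a -> a g s = s' -> a g^-1 s' = s.
Proof. by move=> [a1 aM] <-; rewrite -aM mulVg a1. Qed.

Lemma is_actionX (G : groupType) (S : Type) (a : G -> S -> S) g n s :
  is_action a -> a (g ^+ n) s = iter n (a g) s.
Proof. by move=> [a1 aM]; elim: n => //= n <-; rewrite expgS aM. Qed.

(** The elements acting trivially form a normal subgroup containing [R], so the choice of a
    representative does not matter. *)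
Lemma quot_action (G : groupType) (R : set G) (S : Type) (a : G -> S -> S) :
  is_action a -> (forall r s, R r -> a r s = s) ->
  exists2 b : quot_group R -> S -> S, is_action b &
    forall g s, b (quot_proj R g) s = a g s.
Proof.
move=> aA aR; have [a1 aM] := aA.
have KM g h : (forall s, a g s = s) -> (forall s, a h s = s) ->
  forall s, a (g * h) s = s by move=> ag ah s; rewrite aM ah ag.
have KV g : (forall s, a g s = s) -> forall s, a g^-1 s = s.
  by move=> ag s; exact: is_actionV.
pose K := @Subgroup G [set g | forall s, a g s = s] a1 KM KV.
have nK : normal_subgroup K.
  by move=> x y /= ax s; rewrite !aM ax -aM mulgV a1.
have RK : R `<=` K by move=> r Rr s; exact: aR.
pose b (q : quot_group R) s := a (repr q) s.
have bE g s : b (quot_proj R g) s = a g s.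
  have := repr_quot (S := R) g nK RK => /= /(_ s) e.
  by rewrite /b -{1}e -aM mulVKg.
exists b => //; split=> [s|g h s].
  by have <- : quot_proj R 1 = 1; [exact: gmulf1|rewrite bE].
by rewrite -(quot_projK g) -(quot_projK h) -gmulfM !bE aM.
Qed.

Lemma free_product_action (G H : groupType) (S : Type)
    (a : G -> S -> S) (b : H -> S -> S) :
  is_action a -> is_action b ->
  exists2 c : free_product G H -> S -> S, is_action c &
    (forall g s, c (fp_inl H g) s = a g s) /\
    (forall h s, c (fp_inr G h) s = b h s).
Proof.
move=> [a1 aM] [b1 bM].
pose l (x : G + H) s := match x with inl g => a g s | inr h => b h s end.
pose w (u : seq (G + H)) s := foldr l s u.
have wE u v s : wcongr (@fp_rel G H) u v -> w u s = w v s.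
  move=> uv; elim: uv s => {u v} [u v [x y|x y||] s|//|||].
  - by rewrite /= aM.
  - by rewrite /= bM.
  - exact: a1.
  - exact: b1.
  - by move=> u v _ e s; rewrite e.
  - by move=> u v z _ e _ e' s; rewrite e.
  - by move=> u u' v v' _ e _ e' s; rewrite /w !foldr_cat -/(w v s) e'; exact: e.
pose c (x : free_product G H) s := w (repr (x : wgroup (free_product_pres G H))) s.
have cE (u : seq (letter (free_product_pres G H))) s :
    c (@wclass (free_product_pres G H) u) s = w u s.
  apply: (wE (repr (@wclass (free_product_pres G H) u)) u).
  exact: (@repr_wclass (free_product_pres G H) u).
exists c; last by split=> x s; rewrite cE.
split=> [s|x y s]; first exact: cE.
by rewrite -(wclassK x) -(wclassK y) -wclass_cat !cE /w foldr_cat.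
Qed.

Section IntIter.
Variables (S : Type) (t t' : S -> S).
Hypotheses (tK : cancel t t') (t'K : cancel t' t).

(** [Negz n] denotes -(n+1), hence the [n.+1] iterations of the inverse. *)
Definition int_iter (z : int) : S -> S :=
  match z with Posz n => iter n t | Negz n => iter n.+1 t' end.

Lemma int_iter1 (z : int) s : int_iter (1 + z)%R s = t (int_iter z s).
Proof.
case: z => [n|[|n]]; first by rewrite -PoszD add1n.
  by rewrite [in LHS]/= t'K.
have -> : (1 + Negz n.+1)%R = Negz n.
  by rewrite !NegzE [X in (- X)%R]intS opprD addrA subrr add0r.
by rewrite /int_iter (iterS n.+1) t'K.
Qed.

Lemma int_iterN1 (z : int) s : int_iter (-1 + z)%R s = t' (int_iter z s).
Proof. by apply: (can_inj tK); rewrite t'K -int_iter1 addrA subrr add0r. Qed.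

Lemma int_iterD (y z : int) s : int_iter (y + z)%R s = int_iter y (int_iter z s).
Proof.
elim/int_ind: y => [|n IH|n IH]; first by rewrite add0r.
  by rewrite intS -addrA !int_iter1 IH.
by rewrite intS opprD -addrA !int_iterN1 IH.
Qed.

Lemma int_iter_fix z s : t s = s -> int_iter z s = s.
Proof.
move=> ts; have t's : t' s = s by rewrite -{1}ts tK.
by elim/int_ind: z => // n IH; rewrite intS ?opprD ?int_iter1 ?int_iterN1 IH.
Qed.

End IntIter.

(** The free group acts through the exponent sum. The HNN relators act trivially by the equivariance
    of [t], and those in [R] because their exponent sum is 0. *)
Lemma Gphi_action (U : topGroupType) (phi : open_mono U) (X : finType)
    (R : set (free_group X)) (S : Type) (a : U -> S -> S) (t t' : S -> S) :
  balanced R -> is_action a -> cancel t t' -> cancel t' t ->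
  (forall w s, sgset (om_dom phi) w -> t (a w s) = a (phi w) (t s)) ->
  exists2 b : Gphi phi R -> S -> S, is_action b &
    (forall u s, b (Gphi_base phi R u) s = a u s) /\
    (forall f s, b (Gphi_pres phi R (quot_proj R f)) s =
       int_iter t t' (exponent_sum f) s).
Proof.
move=> hR aA tK t'K ta; have [a1 aM] := aA.
have iA : is_action (fun f : free_group X => int_iter t t' (exponent_sum f)).
  split=> [s|f g s]; last by rewrite exponent_sumM int_iterD.
  have -> // : exponent_sum (1 : free_group X) = 0%R.
  by apply: (addrI (exponent_sum (1 : free_group X))); rewrite -exponent_sumM mulg1 addr0.
have [c cA [cl cr]] := free_product_action aA iA; have [c1 cM] := cA.
have [d dA dE] : exists2 d : hnn phi X -> S -> S, is_action d &
    forall g s, d (quot_proj _ g) s = c g s.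
  apply: quot_action => // r s [x [w [Ow ->]]].
  have tx s' : c (fp_inr U (fg_gen x)) s' = t s'.
    by rewrite cr exponent_sum_gen.
  have ct' s' : c (fp_inr U (fg_gen x))^-1 s' = t' s'.
    by apply: is_actionV => //; rewrite tx.
  rewrite !cM tx ct' cl ta // t'K -cl -cM mulgV; exact: c1.
have [b bA bE] : exists2 b : Gphi phi R -> S -> S, is_action b &
    forall g s, b (quot_proj _ g) s = d g s.
  by apply: quot_action => // _ s [r Rr <-]; rewrite dE cr hR.
exists b => //; split=> [u s|f s]; first by rewrite bE dE cl.
by rewrite Gphi_presE bE dE cr.
Qed.

(** * Bijections of a free [U]-set with prescribed values *)

Definition mul_fst (G : groupType) (L : Type) (u : G) (s : G * L) := (u * s.1, s.2).

Lemma mul_fst_action (G : groupType) (L : Type) : is_action (@mul_fst G L).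
Proof. by split=> [[x l]|u v [x l]]; rewrite /mul_fst /= ?mul1g ?mulgA. Qed.

(* The labels [(i, l)] with [l] nonempty only provide room for the
   Cantor-Bernstein argument: the injection going backwards takes its values
   there, so it leaves the prescribed orbits, labelled by [(i, [::])], alone. *)
Lemma open_mono_bijection (U : topGroupType) (phi : open_mono U)
    (sp : nat -> U * nat) :
  (forall i j w, sgset (om_dom phi) w -> (sp i).2 = (sp j).2 ->
    (sp i).1 = phi w * (sp j).1 -> i = j) ->
  exists t t' : U * (nat * seq U) -> U * (nat * seq U), [/\ cancel t t', cancel t' t,
    forall w s, sgset (om_dom phi) w -> t (mul_fst w s) = mul_fst (phi w) (t s)
    & forall i, t (1, (i, [::])) = ((sp i).1, ((sp i).2, [::]))].
Proof.
move=> spI; pose a := @mul_fst U (nat * seq U); pose O : set U := om_dom phi.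
have phiM x y : O x -> O y -> phi (x * y) = phi x * phi y by exact: om_morph.
have phiV x : O x -> phi x^-1 = (phi x)^-1.
  move=> Ox; apply/esym/mulg1_eq; rewrite -phiM ?mulgV ?om1 //.
  exact: subgroupV.
have phiI x y : O x -> O y -> phi x = phi y -> x = y.
  by move=> Ox Oy; apply: om_inj; rewrite inE.
have O1 : (phi @` O) 1 by exists 1; [exact: subgroup1|exact: om1].
have OM x y : (phi @` O) x -> (phi @` O) y -> (phi @` O) (x * y).
  move=> [v Ov <-] [w Ow <-]; exists (v * w); last exact: phiM.
  exact: subgroupM.
have OV x : (phi @` O) x -> (phi @` O) x^-1.
  by move=> [v Ov <-]; exists v^-1; [exact: subgroupV|exact: phiV].
have [r [rO rM]] := right_coset_transversal (om_dom phi).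
have [r' [r'O r'M]] := right_coset_transversal (Subgroup O1 OM OV).
have /choice[psi psiP] (y : U) : exists w, (phi @` O) y -> O w /\ phi w = y.
  have [[w Ow e]|ny] := pselect ((phi @` O) y); first by exists w.
  by exists 1.
have psiO y : (phi @` O) y -> O (psi y) by move=> /psiP[].
have psiK y : (phi @` O) y -> phi (psi y) = y by move=> /psiP[].
(* On the coset [O] of an orbit labelled [(i, [::])], the prescribed value determines [f]. Elsewhere
   [phi] is applied to the [O]-part of [s.1], and pushing the representative on the list keeps the
   right cosets of [O] apart. *)
pose f (s : U * (nat * seq U)) : U * (nat * seq U) :=
  if `[< O s.1 >] && (s.2.2 == [::])
  then (phi s.1 * (sp s.2.1).1, ((sp s.2.1).2, [::]))
  else (phi (s.1 * (r s.1)^-1), (s.2.1, r s.1 :: s.2.2)).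
(* Likewise with the right cosets of [phi(O)] and the partial inverse [psi]; every list in the range
   is nonempty. *)
pose g (s : U * (nat * seq U)) : U * (nat * seq U) :=
  (psi (s.1 * (r' s.1)^-1), (s.2.1, r' s.1 :: s.2.2)).
have fI : injective f.
  move=> [x [i l]] [y [j m]]; rewrite /f /=.
  (* Two prescribed values are separated by [spI], a prescribed and another one by the empty list,
     two others by the recorded representatives. *)
  have [/andP[/asboolP Ox /eqP ->]|_] := ifPn;
    have [/andP[/asboolP Oy /eqP ->]|_] := ifPn => //=.
    move=> [e1 e2].
    have ij : i = j.
      apply: (spI _ _ (x^-1 * y)) => //.
        by apply: subgroupM => //; exact: subgroupV.
      rewrite phiM ?phiV //; last exact: subgroupV.
      by rewrite -mulgA -e1 mulKg.
    by move: e1; rewrite ij => /mulIg /(phiI _ _ Ox Oy) ->.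
  move=> [/(phiI _ _ (rO x) (rO y)) + -> e ->].
  by rewrite e => /mulIg ->.
have gI : injective g.
  move=> [x [i l]] [y [j m]] [/(congr1 phi)]; rewrite /= !psiK; try exact: r'O.
  by move=> + -> e ->; rewrite e => /mulIg ->.
have OMl w x : O w -> O (w * x) <-> O x.
  move=> Ow; split=> Ox; last exact: subgroupM.
  by rewrite -(mulKg w x); apply: subgroupM => //; exact: subgroupV.
have aV w : O w -> exists2 w', O w' & cancel (a w) (a w') /\
    cancel (a (phi w)) (a (phi w')).
  move=> Ow; exists w^-1; first by apply: subgroupV.
  by split=> -[x s]; rewrite /a /mul_fst /= ?phiV // mulKg.
have fE w s : O w -> f (a w s) = a (phi w) (f s).
  case: s => x [i l] Ow; rewrite /f /a /mul_fst /= rM // (asbool_equiv_eq (OMl w x Ow)).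
  case: ifPn => [/andP[/asboolP Ox _]|_] /=; first by rewrite phiM // mulgA.
  by rewrite -mulgA (phiM w) //; exact: rO.
have gE w s : O w -> g (a (phi w) s) = a w (g s).
  case: s => x [i l] Ow; rewrite /g /a /mul_fst /= r'M; last by exists w.
  have r'x : (phi @` O) (x * (r' x)^-1) by exact: r'O.
  have Owx : (phi @` O) (phi w * (x * (r' x)^-1)) by apply: (OM) => //; exists w.
  congr (_, _); rewrite -mulgA; apply: phiI.
  - exact: psiO.
  - by apply: subgroupM => //; exact: psiO.
  - by rewrite phiM ?psiK //; exact: psiO.
have [t [t' [tK t'K tE tf]]] := equivariant_Cantor_Bernstein aV fE gE fI gI.
exists t, t'; split=> // i; rewrite tf /f /=.
  by rewrite asboolT ?om1 ?mul1g //; exact: subgroup1.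
by move=> [].
Qed.

(** * Double cosets, products and compactness *)

(** The images of the [g n] cluster at some [c]. As [K] is open, the [K]-orbit of [c] is a
    neighbourhood of [c], so it is visited infinitely often; two visits share a double coset. *)
Lemma cocompact_double_coset (G : topGroupType) (H K : subgroup G) (g : nat -> G) :
  cocompact H -> open (sgset K) ->
  exists n m k h, [/\ (n < m)%N, sgset K k, sgset H h & g m = k * g n * h].
Proof.
move=> cH oK.
have [c [_ clc]] := cH ((coset_proj H \o g) @ \oo) _ (@filterT _ _ _).
pose y := repr c; pose V := coset_proj H @` [set z | sgset K (z * y^-1)].
have nV : nbhs c V.
  apply: open_nbhs_nbhs; split.
    by apply: coset_proj_open; exact: (@mulg_open G y^-1 (sgset K)).
  by exists y; [rewrite /= mulgV; exact: subgroup1|exact: coset_projK].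
have freq n : exists2 m, (n < m)%N & V (coset_proj H (g m)).
  have [|_ [[m nm <-] Vm]] := clc ((coset_proj H \o g) @` [set m | (n < m)%N]) V _ nV.
    by exists n.+1 => // m nm; exists m.
  by exists m.
have [n _ [z Kz /coset_proj_eq Hz]] := freq 0%N.
have [m nm [w Kw /coset_proj_eq Hw]] := freq n.
exists n, m, (w * y^-1 * (z * y^-1)^-1), ((z^-1 * g n)^-1 * (w^-1 * g m)); split=> //.
- by apply: subgroupM => //; exact: subgroupV.
- by apply: subgroupM => //; exact: subgroupV.
- by rewrite !invgM !invgK !mulgA mulgVK mulgK mulgVK mulgV mul1g.
Qed.

(** Stating the hypothesis letter by letter covers empty [X] as well. A generator moves past [U] by
    [phi], and its inverse does so because [phi] is onto [U]. *)
Lemma Gphi_base_pres_mul (U : topGroupType) (phi : open_mono U) (X : finType)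
    (R : set (free_group X)) :
  (forall t : X, [/\ phi @` om_dom phi = om_dom phi & sgset (om_dom phi) = setT]) ->
  forall g : Gphi phi R, exists u f, g = Gphi_base phi R u * Gphi_pres phi R f.
Proof.
move=> hX g.
pose b := hnn_base phi X; pose fr := hnn_free phi (X := X).
suff [u [f e]] : exists u f, repr g = b u * fr f.
  exists u, (quot_proj R f); rewrite Gphi_presE -(quot_projK g) e.
  by rewrite gmulfM.
have comm f u : exists u', fr f * b u = b u' * fr f.
  elim/wgroup_ind: f u => [|[t s] f IH] u.
    by exists u; rewrite /fr gmulf1 mul1g mulg1.
  have [e1 e2] := hX t.
  have [u1 e] := IH u.
  suff [u' e'] : exists u', fr (@wclass (free_group_pres X) [:: (t, s)]) * b u1 =
      b u' * fr (@wclass (free_group_pres X) [:: (t, s)]).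
    exists u'; rewrite /fr gmulfM -mulgA -/(fr f) e mulgA e' -mulgA.
    by [].
  case: s.
    by exists (phi u1); apply: hnn_rel; rewrite e2.
  have [w Ow ew] : (phi @` om_dom phi) u1 by rewrite e1 e2.
  exists w; rewrite fg_genV /fr gmulfV.
  apply: (mulgI (fr (fg_gen t))); rewrite mulVKg mulgA hnn_rel //.
  by rewrite ew mulgK.
elim/hnn_ind: (repr g) => [|g1 g2 [u1 [f1 ->]] [u2 [f2 ->]]|u|t|t].
- by exists 1, 1; rewrite /b /fr !gmulf1 mulg1.
- have [u e] := comm f1 u2; exists (u1 * u), (f1 * f2).
  by rewrite /b /fr !gmulfM mulgA -(mulgA (hnn_base _ _ u1)) e !mulgA.
- by exists u, 1; rewrite /fr gmulf1 mulg1.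
- by exists 1, (fg_gen t); rewrite /b gmulf1 mul1g.
- by exists 1, (fg_gen t)^-1; rewrite /b /fr gmulf1 gmulfV mul1g.
Qed.

(** The image filter has a cluster point, which lies in the closed range of [j]; openness and
    injectivity of [j] bring it back to [S]. *)
Lemma compact_open_embedding (S T : topologicalType) (j : S -> T) :
  compact [set: T] -> injective j -> (forall W, open W -> open (j @` W)) ->
  closed (range j) -> compact [set: S].
Proof.
move=> cT jI oj clj F PF _.
have [c [_ clc]] := cT (j @ F) _ (@filterT _ _ _).
have [u _ ju] : range j c.
  apply: clj => B; apply: clc.
  by apply: (@filterS S F _ setT) => [x _|]; [exists x|exact: filterT].
exists u; split=> // A B FA; rewrite nbhsE => -[W [oW Wu] WB].
have [||_ [[x Ax <-] [y Wy /jI yx]]] := clc (j @` A) (j @` W).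
- by apply: (@filterS S F _ A) FA => x Ax; exists x.
- by apply: open_nbhs_nbhs; split; [exact: oj|exists u].
- by exists x; split=> //; apply: WB; rewrite -yx.
Qed.

(** * Topology and double cosets of [Gphi] *)

Section GphiGeometry.
Variables (U : topGroupType) (phi : open_mono U) (X : finType).
Variable R : set (free_group X).
Local Notation base := (Gphi_base phi R).
Local Notation pres := (Gphi_pres phi R).

Lemma Gphi_open (V : set (Gphi phi R)) :
  (forall g, open [set u | V (g * base u)]) -> open V.
Proof.
move=> oV.
have {}oV : hnn_open (coset_proj (normal_closure (hnn_free phi (X := X) @` R)) @^-1` V).
  move=> g; have := oV (quot_proj _ g); congr (open _).
  by apply/seteqP; split=> u /=; rewrite -gmulfM.
exact: oV.
Qed.

Lemma Gphi_base_open (W : set U) : open W -> open (base @` W).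
Proof.
move=> oW; have := @coset_proj_open _ (normal_closure (hnn_free phi (X := X) @` R)) _
  (@hnn_base_open _ phi X _ oW).
congr (open _); apply/seteqP; split=> [_ [_ [u Wu <-] <-]|_ [u Wu <-]].
  by exists u.
by exists (hnn_base phi X u) => //; exists u.
Qed.

Lemma Gphi_base_continuous : continuous base.
Proof.
move=> u; apply: (@continuous_comp _ _ _ (hnn_base phi X)
  (coset_proj (normal_closure (hnn_free phi (X := X) @` R)))).
  exact: hnn_base_continuous.
exact: coset_proj_continuous.
Qed.

Lemma closed_Gphi_base : closed (range base).
Proof.
rewrite -openC; apply: Gphi_open => g.
(* A left coset of the image of [U] is either that image or disjoint from it. *)
have [[u0 _ e0]|ng] := pselect (range base g).
  rewrite (_ : [set u | _] = set0); first exact: open0.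
  apply/seteqP; split=> // u /= []; exists (u0 * u) => //.
  by rewrite gmulfM /= e0.
rewrite (_ : [set u | _] = setT); first exact: openT.
apply/seteqP; split=> // u _ /= [v _ e]; apply: ng; exists (v * u^-1) => //.
by rewrite gmulfM gmulfV /= e mulgK.
Qed.

(** With [t] fixing the point [(1, (0, [::]))], [pres g] fixes it too, while [base u] moves its
    first coordinate to [u]. *)
Lemma Gphi_base_pres_eq1 u g : balanced R -> base u = pres g -> u = 1.
Proof.
move=> hR; rewrite -(quot_projK g) => e.
have [|t [t' [tK t'K tE t1]]] := @open_mono_bijection _ phi (fun n => (1, n)).
  by move=> i j w _ /=.
have [b bA [bU bG]] := Gphi_action hR (@mul_fst_action _ _) tK t'K tE.
have := bU u (1, (0%N, [::])); rewrite e bG (int_iter_fix tK t'K) //.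
by rewrite /mul_fst /= mulg1 => -[].
Qed.

(** By the trivial intersection, each left coset of [U] meets [G] in at most one point, and points
    of [U] are closed. *)
Lemma closed_Gphi_pres : hausdorff_space U -> balanced R -> closed (range pres).
Proof.
move=> hU hR; rewrite -openC; apply: Gphi_open => g.
have [[u0 [f0 _ e0]]|ng] := pselect (exists u0, range pres (g * base u0)).
  rewrite (_ : [set u | _] = ~` [set u0]).
    by apply: closed_openC; apply: accessible_closed_set1; exact: hausdorff_accessible.
  apply/seteqP; split=> u /=.
    by move=> nu uu0; apply: nu; rewrite uu0; exists f0.
  move=> uu0 [f _ e]; apply: uu0; apply: (mulgI u0^-1); rewrite mulVg.
  apply: (@Gphi_base_pres_eq1 _ (f0^-1 * f) hR).
  by rewrite !gmulfM !gmulfV /= e e0 invgM !mulgA mulgVK.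
rewrite (_ : [set u | _] = setT); first exact: openT.
by apply/seteqP; split=> // u _ /= gu; apply: ng; exists u.
Qed.

Lemma Gphi_base_gen_expn_inj (x : X) n m u v : balanced R ->
  pres (quot_proj R (fg_gen x)) ^+ m =
    base u * pres (quot_proj R (fg_gen x)) ^+ n * base v -> n = m.
Proof.
move=> hR e.
have tK : cancel (fun z : int => 1 + z)%R (fun z : int => -1 + z)%R.
  by move=> z; rewrite addrA addNr add0r.
have t'K : cancel (fun z : int => -1 + z)%R (fun z : int => 1 + z)%R.
  by move=> z; rewrite addrA subrr add0r.
have [b bA [bU bG]] := @Gphi_action U phi X R int (fun _ z => z) _ _ hR
  (conj (fun=> erefl) (fun _ _ _ => erefl)) tK t'K (fun _ _ _ => erefl).
have bx k : b (pres (quot_proj R (fg_gen x)) ^+ k) 0%R = k.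
  rewrite is_actionX //; elim: k => //= k ->.
  by rewrite bG exponent_sum_gen /= intS.
have := bx m; rewrite e; have [_ bM] := bA.
by rewrite !bM !bU bx => -[].
Qed.

(* With [s_k = (1, (k, [::]))], the bijection [t] below fixes [s_0], sends [s_1]
   to [u0 s_0] and [s_(k+1)] to [s_k] for [k > 0], so that [x^-k u0 s_0 = s_k]. *)
Lemma exists_distinct_double_cosets (x : X) : balanced R ->
  phi @` om_dom phi != setT -> exists g : nat -> Gphi phi R,
  forall n m k h, g m = base k * g n * pres h -> n = m.
Proof.
move=> hR; rewrite setTPn => -[u0 nu0].
pose sp n := if n is k.+1 then (if k is _.+1 then 1 else u0, k) else (1, 0%N).
have [|t [t' [tK t'K tE t1]]] := @open_mono_bijection _ phi sp.
  (* Only the indices 0 and 1 share an orbit, and their values 1 and [u0] are not in the same right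
     coset of [phi(O)]. *)
  move=> [|[|i]] [|[|j]] w Ow //= ij; rewrite ?mulg1.
  - move=> e; case: nu0; exists w^-1; first exact: subgroupV.
    by apply: (mulgI (phi w)); rewrite -e -om_morph ?mulgV ?om1 //; exact: subgroupV.
  - by move=> e; case: nu0; exists w.
  - by rewrite ij.
have [b bA [bU bG]] := Gphi_action hR (@mul_fst_action _ _) tK t'K tE; have [_ bM] := bA.
pose s k : U * (nat * seq U) := (1, (k, [::])).
pose y := pres (quot_proj R (fg_gen x)).
have bx z : b y z = t z by rewrite bG exponent_sum_gen.
exists (fun n => y^-1 ^+ n.+1 * base u0) => n m k h e.
have bg i : b (y^-1 ^+ i.+1 * base u0) (s 0%N) = s i.+1.
  rewrite bM bU is_actionX //; elim: i => [|i IH].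
    by apply: is_actionV => //; rewrite bx t1 /mul_fst /= mulg1.
  by rewrite iterS IH; apply: is_actionV => //; rewrite bx t1.
have := bg m; rewrite e 2!bM -(quot_projK h) bG (int_iter_fix tK t'K); last exact: t1.
by rewrite bg bU /mul_fst /= => -[].
Qed.

End GphiGeometry.

(** * Cocompactness of [U] and of [G] *)

Theorem theorem3p18 (U : topGroupType) (hU : hausdorff_space U)
    (phi : open_mono U) (hphi : phi @` om_dom phi `<=` om_dom phi)
    (X : finType) (R : set (free_group X)) (hR : balanced R) :
  (closed (range (Gphi_base phi R)) /\
   (cocompact (range_subgroup (Gphi_base phi R)) <-> #|X| = 0%N)) /\
  (closed (range (Gphi_pres phi R)) /\
   (cocompact (range_subgroup (Gphi_pres phi R)) <->
      (#|X| = 0%N /\ compact [set: U]) \/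
      (phi @` om_dom phi = om_dom phi /\ sgset (om_dom phi) = [set: U] /\
       compact [set: U]))).
Proof.
have openU : open (range (Gphi_base phi R)) by apply: Gphi_base_open; exact: openT.
have X0 : #|X| = 0%N -> X -> False by move=> /card0_eq/[swap] x /(_ x).
have Xx : #|X| != 0%N -> X by rewrite -lt0n => /card_gt0P/cid[x _].
pose K := range_subgroup (Gphi_base phi R).
split; (split; [|split]).
- exact: closed_Gphi_base.
- move=> cK; apply: contrapT => /eqP/Xx x.
  have [n [m [k [h [nm [u _ <-] [v _ <-] e]]]]] := cocompact_double_coset
    (K := K) (fun n => Gphi_pres phi R (quot_proj R (fg_gen x)) ^+ n) cK openU.
  by move: nm; rewrite (Gphi_base_gen_expn_inj hR e) ltnn.
- move=> /X0 nX.
  rewrite /cocompact (_ : [set: _] = [set coset_proj K 1]); first exact: compact_set1.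
  apply/seteqP; split=> // c _; rewrite -(coset_projK c) /=; apply/coset_proj_eq.
  rewrite mulg1; apply: subgroupV.
  have F1 (f : free_group X) : f = 1.
    by elim/wgroup_ind: f => [//|[t ?] f _]; case: (nX t).
  have [t|u [f ->]] := @Gphi_base_pres_mul _ phi X R _ (repr c); first by case: (nX t).
  exists u => //.
  have -> : f = 1 by rewrite -(quot_projK f) (F1 (repr f)); exact: gmulf1.
  by rewrite gmulf1 mulg1.
- exact: closed_Gphi_pres.
- move=> cG.
  (* [U] inherits compactness through [j], an open injection with closed range. *)
  pose j u := coset_proj (range_subgroup (Gphi_pres phi R)) (Gphi_base phi R u).
  have cU : compact [set: U].
    apply: (compact_open_embedding (j := j) cG).
    + move=> u v /coset_proj_eq [g _ e]; apply: (mulgI u^-1); rewrite mulVg.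
      apply/esym/(Gphi_base_pres_eq1 (phi := phi) (g := g) hR).
      by rewrite gmulfM gmulfV /= e.
    + move=> W oW.
      have -> : j @` W = coset_proj _ @` (Gphi_base phi R @` W) by rewrite image_comp.
      by apply: coset_proj_open; exact: Gphi_base_open.
    + rewrite -openC.
      (* The complement of [U G] is a union of right cosets of the open subgroup [K], so it is open
         and projects to the complement of [range j]. *)
      pose V : set (Gphi phi R) :=
        [set g | ~ exists u f, g = Gphi_base phi R u * Gphi_pres phi R f].
      have -> : ~` range j = coset_proj _ @` V.
        apply/seteqP; split=> [c jc|_ [g Vg <-] [u _ /coset_proj_eq [f _ e]]].
          exists (repr c); last exact: coset_projK.
          move=> [u [f e]]; apply: jc; exists u => //; rewrite -(coset_projK c) e.
          by apply/coset_proj_eq; rewrite mulKg; exists f.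
        by apply: Vg; exists u, f; rewrite e mulVKg.
      apply: coset_proj_open.
      have -> : V = \bigcup_(y in V) [set z | sgset K (z * y^-1)].
        apply/seteqP; split=> [z Vz|z [y Vy [v _ e]] [u [f ez]]].
          by exists z; rewrite //= mulgV; exists 1; rewrite ?gmulf1.
        apply: Vy; exists (v^-1 * u), f.
        by rewrite gmulfM gmulfV /= e invgM invgK -!mulgA -ez mulVg mulg1.
      by apply: bigcup_open => y _; exact: (@mulg_open _ y^-1 (sgset K)).
  have [X0'|/Xx x] := eqVneq #|X| 0%N; [by left|right].
  have phiT : phi @` om_dom phi = setT.
    apply: contrapT => /eqP/(exists_distinct_double_cosets x hR)[g gP].
    have [n [m [k [h [nm [u _ <-] [v _ <-] e]]]]] :=
      cocompact_double_coset (K := K) g cG openU.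
    by move: nm; rewrite (gP _ _ _ _ e) ltnn.
  have OT : sgset (om_dom phi) = setT by apply/seteqP; split=> // u _; apply: hphi; rewrite phiT.
  by rewrite phiT OT.
- move=> H.
  have [cU hX] : compact [set: U] /\ forall t : X,
      phi @` om_dom phi = om_dom phi /\ sgset (om_dom phi) = setT.
    case: H => [[/X0 nX cU]|[e1 [e2 cU]]]; last by split.
    by split=> // t; case: (nX t).
  (* Since every element of [Gphi] is a product from [U] and [G], [j] maps the compact [U] onto the
     coset space. *)
  pose j u := coset_proj (range_subgroup (Gphi_pres phi R)) (Gphi_base phi R u).
  rewrite /cocompact (_ : [set: _] = j @` setT).
    apply: continuous_compact => //; apply: continuous_subspaceT => u.
    apply: (@continuous_comp _ _ _ (Gphi_base phi R)
      (coset_proj (range_subgroup (Gphi_pres phi R)))).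
      exact: Gphi_base_continuous.
    exact: coset_proj_continuous.
  apply/seteqP; split=> // c _; have [t|u [f e]] := @Gphi_base_pres_mul _ phi X R _ (repr c).
    by have [] := hX t.
  exists u => //; rewrite -(coset_projK c) e; apply/coset_proj_eq.
  by rewrite mulKg; exists f.
Qed.
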